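(* Let $q$ be a prime power, $G=PSL_2(q)$, and let $a$, $t$, $a_k$, $\alpha_r$ and, for $q$ odd, $b$, $b_\ell$, $\beta_r$, $\gamma_r$ be as defined in the context. Then for every $1\le k\le t-1$, $$[u(a)\cdot s]^{k}=u(a_k)\cdot s\cdot u(x_k)\cdot h(y_k),\qquad x_k=-\alpha_{k-2}(a)\,\alpha_{k-1}(a),\quad y_k=\alpha_{k-1}(a),$$ and, if $q$ is odd, for every $0\le\ell\le t-1$, $$[u(a)\cdot s]^{\ell}\cdot[u(b)\cdot s\cdot u(-b)]=u(b_\ell)\cdot s\cdot u(x'_\ell)\cdot h(y'_\ell),\qquad x'_\ell=-\beta_{\ell-1}(a,b)\,\gamma_{\ell-1}(a,b),\quad y'_\ell=\beta_{\ell-1}(a,b).$$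
   Context: $PSL_2(q)=SL_2(\mathbb{F}_q)/\{\pm I\}$. For $x\in\mathbb{F}_q$, $y\in\mathbb{F}_q^*$, $u(x)$, $h(y)$, $s$ denote the images in $PSL_2(q)$ of $\begin{pmatrix}1&x\\0&1\end{pmatrix}$, $\begin{pmatrix}y&0\\0&y^{-1}\end{pmatrix}$, $\begin{pmatrix}0&1\\-1&0\end{pmatrix}$. $B=\{u(x)h(y)\}$ is the image of the upper triangular matrices. Choice of $a,b,t$: $a\in\mathbb{F}_q$ is such that $\lambda^2-a\lambda+1$ is irreducible over $\mathbb{F}_q$ with a root of order $q+1$ in $\mathbb{F}_{q^2}^*$; $t=\frac{q+1}{\gcd(2,q+1)}$ (the order of $u(a)s$). If $q$ is odd, $b\in\mathbb{F}_q$ is such that $u(b)s\notin[u(a)s]^kB$ for all $0\le k<t$. Every $g\in PSL_2(q)\setminus B$ can be written $g=u(c)\,s\,u(x)\,h(y)$ with a unique $c\in\mathbb{F}_q$ (and some $x\in\mathbb F_q$, $y\in\mathbb F_q^*$). For $1\le k\le t-1$, $a_k$ is this $c$ for $g=[u(a)s]^k$; for $q$ odd and $0\le\ell\le t-1$, $b_\ell$ is this $c$ for $g=[u(a)s]^\ell[u(b)s\,u(-b)]$ (these elements do not lie in $B$). $\alpha_{-1}(a)=0$, and for $k\ge0$, $\alpha_k(a)=\sum_{i=0}^{\lfloor k/2\rfloor}(-1)^i\binom{k-i}{i}a^{k-2i}$ (the Dickson polynomial of the second kind $E_k(a,1)$), so $\alpha_0(a)=1$ and $\alpha_{k+1}(a)=a\alpha_k(a)-\alpha_{k-1}(a)$.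 $\beta_{-1}(a,b)=1$, $\beta_k(a,b)=b\,\alpha_k(a)-\alpha_{k-1}(a)$ for $k\ge0$, and $\gamma_k(a,b)=\alpha_k(a)+b\,\beta_k(a,b)$ for $k\ge-1$. *)

(* Defs.v *)
From HB Require Import structures.
From mathcomp Require Import all_boot all_order all_algebra all_fingroup.
From mathcomp Require Import ring.

Set Implicit Arguments.
Unset Strict Implicit.
Unset Printing Implicit Defensive.

Import GroupScope GRing.Theory.
Local Open Scope ring_scope.

Section MatrixTwo.
Variable R : comNzRingType.
Implicit Types M N : 'M[R]_2.

Definition mx2 (p q r s : R) : 'M[R]_2 :=
  \matrix_(i < 2, j < 2)
    if i == 0 then (if j == 0 then p else q) else (if j == 0 then r else s).

Lemma mx2_eqP M N :
  [/\ M 0 0 = N 0 0, M 0 1 = N 0 1, M 1 0 = N 1 0 & M 1 1 = N 1 1] -> M = N.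
Proof.
case=> e00 e01 e10 e11; apply/matrixP=> i j.
have o2 (k : 'I_2) : k = 0 \/ k = 1.
  by case: k => [[|[|//]] lt_k]; [left | right]; apply/val_inj.
by case: (o2 i) => ->; case: (o2 j) => ->.
Qed.

Lemma mx2_eta M : M = mx2 (M 0 0) (M 0 1) (M 1 0) (M 1 1).
Proof. by apply: mx2_eqP; rewrite !mxE. Qed.

Lemma det_mx22E M : \det M = M 0 0 * M 1 1 - M 0 1 * M 1 0.
Proof.
rewrite (expand_det_row _ 0) !big_ord_recl big_ord0 addr0 /cofactor !det_mx11.
rewrite !mxE /= expr0 mul1r expr1 mulN1r mulrN.
by congr (_ * M _ _ - M _ _ * M _ _); apply/val_inj.
Qed.

Lemma det_mx2E p q r s : \det (mx2 p q r s) = p * s - q * r.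
Proof. by rewrite det_mx22E !mxE. Qed.

Lemma mul_mx2 p q r s p' q' r' s' :
  mx2 p q r s *m mx2 p' q' r' s' =
  mx2 (p * p' + q * r') (p * q' + q * s') (r * p' + s * r') (r * q' + s * s').
Proof.
by apply: mx2_eqP; rewrite !mxE !big_ord_recl !big_ord0 !mxE /= !addr0.
Qed.

Lemma opp_mx2 p q r s : - mx2 p q r s = mx2 (- p) (- q) (- r) (- s).
Proof. by apply: mx2_eqP; rewrite !mxE. Qed.

End MatrixTwo.

Section SL2.
Variable F : finFieldType.

Record SL2 := MkSL2 { sl2val :> 'M[F]_2; _ : \det sl2val == 1 }.

HB.instance Definition _ := [isSub for sl2val].
HB.instance Definition _ := [Finite of SL2 by <:].

Implicit Types g h : SL2.

Lemma SL2_det g : \det (val g) = 1.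
Proof. exact/eqP/(valP g). Qed.

Fact SL2_one_subproof : \det (1%:M : 'M[F]_2) == 1.
Proof. by rewrite det1. Qed.

Fact SL2_mul_subproof g h : \det (val g *m val h) == 1.
Proof. by rewrite det_mulmx !SL2_det mulr1. Qed.

Fact SL2_inv_subproof g : \det (invmx (val g)) == 1.
Proof. by rewrite det_inv SL2_det invr1. Qed.

Definition SL2_one := MkSL2 SL2_one_subproof.
Definition SL2_mul g h := MkSL2 (SL2_mul_subproof g h).
Definition SL2_inv g := MkSL2 (SL2_inv_subproof g).

Fact SL2_mulA : associative SL2_mul.
Proof. by move=> g h k; apply/val_inj/mulmxA. Qed.

Fact SL2_mul1 : left_id SL2_one SL2_mul.
Proof. by move=> g; apply/val_inj/mul1mx. Qed.

Fact SL2_mulV : left_inverse SL2_one SL2_inv SL2_mul.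
Proof.
by move=> g; apply/val_inj/mulVmx; rewrite unitmxE SL2_det unitr1.
Qed.

HB.instance Definition _ := Finite_isGroup.Build SL2 SL2_mulA SL2_mul1 SL2_mulV.

Lemma SL2_valM g h : val (g * h)%g = val g *m val h.
Proof. by []. Qed.

Definition pmI : {set SL2} :=
  [set g : SL2 | (val g == 1%:M) || (val g == - 1%:M)].

Lemma pmIP g : reflect (val g = 1%:M \/ val g = - 1%:M) (g \in pmI).
Proof.
rewrite inE; apply: (iffP orP).
  by case=> /eqP; [left | right].
by case=> ->; [left | right].
Qed.

Fact pmI_group_set : group_set pmI.
Proof.
apply/group_setP; split; first by apply/pmIP; left.
move=> g h /pmIP gI /pmIP hI; apply/pmIP; rewrite SL2_valM.
by case: gI => ->; case: hI => ->; rewrite ?mulNmx mul1mx ?opprK; auto.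
Qed.

Canonical pmI_group := Group pmI_group_set.

Lemma pmI_norm g : g \in 'N(pmI).
Proof.
apply: (subsetP (cent_sub _)); apply/centP=> h /pmIP hI; apply: val_inj.
by case: hI => hI; rewrite !SL2_valM hI ?mulmxN ?mulNmx mul1mx mulmx1.
Qed.

Lemma pmI_normal : pmI_group <| [set: SL2].
Proof. by apply/normalP; split=> [|g _]; rewrite ?subsetT ?(normP (pmI_norm g)). Qed.

End SL2.

(* As pmI F is normal in [set: SL2 F], the type of its bilateral cosets is the
   whole quotient group. *)
Definition PSL2 (F : finFieldType) : finGroupType := coset_of (pmI_group F).

Section Elements.
Variable F : finFieldType.

Definition toPSL2 (g : SL2 F) : PSL2 F := coset (pmI_group F) g.

Lemma toPSL2M (g h : SL2 F) : toPSL2 (g * h)%g = (toPSL2 g * toPSL2 h)%g.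
Proof. by rewrite /toPSL2 morphM ?pmI_norm. Qed.

Lemma toPSL2_surj (x : PSL2 F) : exists g, x = toPSL2 g.
Proof. by have [g _ ->] := cosetP x; exists g. Qed.

Lemma toPSL2_eqP (g h : SL2 F) :
  reflect (val g = val h \/ val g = - val h) (toPSL2 g == toPSL2 h).
Proof.
rewrite /toPSL2; apply: (iffP eqP).
  move/(rcoset_kercosetP (pmI_norm g) (pmI_norm h))/rcosetP=> [k /pmIP kI ->].
  by rewrite SL2_valM; case: kI => ->; rewrite ?mulNmx mul1mx; auto.
move=> e; apply/(rcoset_kercosetP (pmI_norm g) (pmI_norm h)).
rewrite mem_rcoset; apply/pmIP.
have hV : val h *m val h^-1%g = 1%:M by rewrite -SL2_valM mulgV.
by rewrite SL2_valM; case: e => ->; rewrite ?mulNmx hV; auto.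
Qed.

Fact umx_subproof (x : F) : \det (mx2 1 x 0 1) == 1.
Proof. by rewrite det_mx2E mulr0 subr0 mulr1. Qed.

Fact hmx_subproof (y : {unit F}) : \det (mx2 (val y) 0 0 (val y)^-1) == 1.
Proof. by rewrite det_mx2E mul0r subr0 divrr ?(valP y). Qed.

Fact smx_subproof : \det (mx2 0 1 (-1) 0 : 'M[F]_2) == 1.
Proof. by rewrite det_mx2E mul0r sub0r mul1r opprK. Qed.

Definition u (x : F) : PSL2 F := toPSL2 (MkSL2 (umx_subproof x)).
Definition h (y : {unit F}) : PSL2 F := toPSL2 (MkSL2 (hmx_subproof y)).
Definition s : PSL2 F := toPSL2 (MkSL2 smx_subproof).

Definition B : {set PSL2 F} := [set (u x * h y)%g | x in F, y in {: {unit F}}].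

(* The c such that g = u(c) s u(x) h(y) for some x and y; it exists, uniquely,
   when g is outside B (see bruhat_coordE and bruhat_coordP), and is set to 0
   by default otherwise. *)
Definition bruhat_coord (g : PSL2 F) : F :=
  odflt 0 [pick c : F |
    [exists x : F, exists y : {unit F}, g == (u c * s * u x * h y)%g]].

Definition SL2_of_prod (c x : F) (y : {unit F}) : SL2 F :=
  (MkSL2 (umx_subproof c) * MkSL2 smx_subproof * MkSL2 (umx_subproof x)
     * MkSL2 (hmx_subproof y))%g.

Lemma usuhE c x y : (u c * s * u x * h y)%g = toPSL2 (SL2_of_prod c x y).
Proof. by rewrite !toPSL2M. Qed.

Lemma SL2_of_prodE c x (y : {unit F}) :
  val (SL2_of_prod c x y) =
  mx2 (- c * val y) ((1 - c * x) / val y) (- val y) (- x / val y).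
Proof.
by rewrite /SL2_of_prod !SL2_valM /= !mul_mx2; congr mx2; ring.
Qed.

Lemma usuh_inj c x (y : {unit F}) c' x' (y' : {unit F}) :
  (u c * s * u x * h y)%g = (u c' * s * u x' * h y')%g -> c = c'.
Proof.
rewrite !usuhE => /eqP/toPSL2_eqP; rewrite !SL2_of_prodE opp_mx2.
have y0 : val y != 0 by rewrite -unitfE (valP y).
have lin (d : F) : - val y = d -> - c * val y = c' * d -> c = c'.
  by move=> <- /eqP; rewrite mulrN mulNr eqr_opp => /eqP/(mulIf y0).
case=> /matrixP e; have := e 0 0; have := e 1 0; rewrite !mxE /=.
  by move/lin=> ce /[!mulNr] ce'; apply: ce; rewrite mulrN mulNr.
by move/lin=> ce ce'; apply: ce; rewrite ce' opprK mulNr opprK.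
Qed.

Lemma bruhat_coordE c x (y : {unit F}) :
  bruhat_coord (u c * s * u x * h y)%g = c.
Proof.
rewrite /bruhat_coord; case: pickP => [c' /existsP[x' /existsP[y' /eqP e]] | no].
  by apply/esym; apply: usuh_inj e.
by have /existsP[] := no c; exists x; apply/existsP; exists y.
Qed.

Lemma bruhat_coordP (g : PSL2 F) : g \notin B ->
  exists x y, g = (u (bruhat_coord g) * s * u x * h y)%g.
Proof.
have [m -> {g}] := toPSL2_surj g => gB.
suff [c [x [y e]]] : exists c x y, toPSL2 m = (u c * s * u x * h y)%g.
  by exists x, y; rewrite e bruhat_coordE.
have md : val m 0 0 * val m 1 1 - val m 0 1 * val m 1 0 = 1.
  by rewrite -det_mx22E SL2_det.
have [r0|r0] := eqVneq (val m 1 0) 0.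
  case/negP: gB.
  rewrite r0 mulr0 subr0 in md.
  have pU : val m 0 0 \is a GRing.unit.
    by rewrite unitfE; apply: contra_eq_neq md => ->; rewrite mul0r eq_sym oner_eq0.
  have dE : val m 1 1 = (val m 0 0)^-1 by apply: (mulrI pU); rewrite md mulrV.
  apply/imset2P; exists (val m 0 1 * val m 0 0) (FinRing.unit F pU) => //.
  rewrite /u /h -toPSL2M; apply/eqP/toPSL2_eqP; left.
  rewrite SL2_valM /= mul_mx2 [LHS]mx2_eta r0 dE.
  by congr mx2; rewrite ?mulr0 ?mul0r ?mul1r ?addr0 ?add0r ?mulrK.
have yU : - val m 1 0 \is a GRing.unit by rewrite unitfE oppr_eq0.
exists (val m 0 0 / val m 1 0), (val m 1 0 * val m 1 1), (FinRing.unit F yU).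
rewrite usuhE; apply/eqP/toPSL2_eqP; left; rewrite SL2_of_prodE /=.
rewrite [LHS]mx2_eta; congr mx2.
- by rewrite mulrN mulNr opprK divfK.
- rewrite invrN mulrN mulrA divfK // -[X in _ = - ((X - _) / _)]md.
  by rewrite addrAC subrr add0r mulNr opprK mulfK.
- by rewrite opprK.
- by rewrite invrN mulrNN mulrC mulKf.
Qed.

End Elements.

Arguments s {F}.
Arguments u {F} x%_R.

(* The degree -1 value is encoded by Negz; indices below -1 are never used. *)
Definition alpha (R : nzRingType) (a : R) (k : int) : R :=
  match k with
  | Posz n => \sum_(i < n./2.+1)
                (-1) ^+ i * 'C(n - i, i)%:R * a ^+ (n - 2 * i)
  | Negz _ => 0
  end.

Definition beta (R : nzRingType) (a b : R) (k : int) : R :=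
  match k with
  | Posz n => b * alpha a n%:Z - alpha a (n%:Z - 1)
  | Negz _ => 1
  end.

Definition gamma (R : nzRingType) (a b : R) (k : int) : R :=
  alpha a k + b * beta a b k.

Definition tq (q : nat) : nat := q.+1 %/ gcdn 2 q.+1.

Definition charpoly_a (F : finFieldType) (a : F) : {poly F} :=
  'X^2 - a *: 'X + 1.

Definition good_a (F K : finFieldType) (iota : {rmorphism F -> K}) (a : F) :
    Prop :=
  irreducible_poly (charpoly_a a) /\
  exists2 z : {unit K},
    root (map_poly iota (charpoly_a a)) (val z) & #[z]%g = #|F|.+1.

Definition good_b (F : finFieldType) (a b : F) : Prop :=
  forall k : nat, (k < tq #|F|)%N ->
    (u b * s)%g \notin ((u a * s) ^+ k *: B F)%g.

Definition a_seq (F : finFieldType) (a : F) (k : nat) : F :=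
  bruhat_coord ((u a * s) ^+ k)%g.

Definition b_seq (F : finFieldType) (a b : F) (l : nat) : F :=
  bruhat_coord ((u a * s) ^+ l * (u b * s * u (- b)))%g.

(* Main.v *)
(* Up to sign, u(a) s is the matrix [[a, -1], [1, 0]], of characteristic
   polynomial X^2 - a X + 1, whose n-th power has the entries alpha_n,
   -alpha_(n-1), alpha_(n-1), -alpha_(n-2).  The Bruhat decomposition of an
   element outside B is read off the bottom row of a matrix representing it, so
   everything reduces to the bottom left entry being nonzero.  For the powers
   of u(a) s this entry is alpha_(k-1)(a) = (z^k - z^-k) / (z - z^-1), z being
   the root of order q + 1, and it vanishes iff t divides k; in particular
   (u(a) s)^t = 1.  For the other family, the entry beta_(l-1) vanishes iff
   (u(a) s)^l u(b) s lies in B, i.e. u(b) s lies in (u(a) s)^(t-l) B, which the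
   choice of b excludes. *)
Require Import Defs.
From mathcomp Require Import all_boot all_order all_algebra all_fingroup.
From mathcomp Require Import cyclic ring zify.

Set Implicit Arguments.
Unset Strict Implicit.
Unset Printing Implicit Defensive.

Import GRing.Theory.
Local Open Scope ring_scope.

Section Alpha.
Variable R : comNzRingType.
Implicit Types a : R.

(** The added binomials vanish, as [n - i < i] there; this lets sums of different lengths be
    compared. *)
Lemma alpha_widen a (n m : nat) : (n./2 < m)%N ->
  alpha a n = \sum_(i < m) (-1) ^+ i * 'C(n - i, i)%:R * a ^+ (n - 2 * i).
Proof.
move=> n2m; rewrite /alpha.
rewrite (big_ord_widen m
  (fun i => (-1) ^+ i * 'C(n - i, i)%:R * a ^+ (n - 2 * i))) //.
rewrite big_mkcond; apply: eq_bigr => i _; case: ltnP => // n2i.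
by rewrite bin_small ?mulr0 ?mul0r //; lia.
Qed.

Lemma alpha0 a : alpha a 0%N = 1.
Proof. by rewrite /alpha big_ord_recl big_ord0 /= !expr0 bin0; ring. Qed.

(** Pascal's rule, term by term: index [j.+1] in degrees [n.+2] and [n.+1] is matched with index [j]
    in degree [n]. *)
Lemma alphaS a (n : nat) :
  alpha a n.+1 = a * alpha a n - alpha a (n%:Z - 1).
Proof.
case: n => [|n].
  by rewrite alpha0 /alpha !big_ord_recl !big_ord0 /= !bin0 !expr0; ring.
rewrite (_ : n.+1%:Z - 1 = n%:Z :> int); last by lia.
rewrite (@alpha_widen a n.+2 n.+2); last by lia.
rewrite (@alpha_widen a n.+1 n.+2); last by lia.
rewrite (@alpha_widen a n n.+1); last by lia.
rewrite [in LHS]big_ord_recl [in RHS]big_ord_recl !subn0 !bin0 mulrDr.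
rewrite -addrA; congr (_ + _); first by rewrite exprS; ring.
rewrite mulr_sumr -sumrB; apply: eq_bigr => j _.
rewrite lift0; case: j => j /= ltj.
have -> : (n.+2 - j.+1 = (n - j).+1)%N by lia.
have -> : (n.+1 - j.+1 = n - j)%N by lia.
have -> : (n.+2 - 2 * j.+1 = n - 2 * j)%N by lia.
rewrite binS natrD !exprS.
(* When [n <= 2 * j] the truncated exponents no longer differ by one, but then ['C(n - j, j.+1)] is
   zero. *)
have [le_nj|lt_jn] := leqP n (2 * j).
  by rewrite bin_small; [ring | lia].
have -> : (n - 2 * j = (n.+1 - 2 * j.+1).+1)%N by lia.
by rewrite exprS; ring.
Qed.

End Alpha.

(** This is alpha_n = (z^(n+1) - z^-(n+1)) / (z - z^-1) with denominators cleared. Both sides obey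
    the same second-order recurrence. *)
Lemma rmorph_alpha_root (R S : comNzRingType) (f : {rmorphism R -> S})
    (a : R) (z : S) (n : nat) : z ^+ 2 = f a * z - 1 ->
  f (alpha a n) * ((z ^+ 2 - 1) * z ^+ n) = (z ^+ 2) ^+ n.+1 - 1.
Proof.
move=> zE.
have faz : f a * z = z ^+ 2 + 1 by rewrite zE subrK.
suff [] : f (alpha a n) * ((z ^+ 2 - 1) * z ^+ n) = (z ^+ 2) ^+ n.+1 - 1
    /\ f (alpha a n.+1) * ((z ^+ 2 - 1) * z ^+ n.+1) = (z ^+ 2) ^+ n.+2 - 1.
  by [].
elim: n => [|n [IH IH1]].
  split; first by rewrite alpha0 rmorph1 expr0; ring.
  rewrite alphaS alpha0 (_ : alpha a (0%:Z - 1) = 0) // subr0 mulr1.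
  rewrite mulrCA expr1 faz; ring.
split=> //; rewrite alphaS (_ : n.+1%:Z - 1 = n%:Z :> int); last by lia.
rewrite rmorphB rmorphM.
transitivity ((f a * z) * (f (alpha a n.+1) * ((z ^+ 2 - 1) * z ^+ n.+1))
              - z ^+ 2 * (f (alpha a n) * ((z ^+ 2 - 1) * z ^+ n))).
  by rewrite !exprS; ring.
by rewrite IH IH1 faz !exprS; ring.
Qed.

Section Representatives.
Variable F : finFieldType.
Implicit Types (a b : F) (g : SL2 F) (n l : nat).

Fact usmx_subproof a : \det (mx2 a (-1) 1 0) == 1.
Proof. by rewrite det_mx2E mulr0 sub0r mulr1 opprK. Qed.

(* The opposite of the matrix product u(a) s, so that no sign appears in its
   powers. *)
Definition usmx a : SL2 F := MkSL2 (usmx_subproof a).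

Lemma usE a : (u a * s)%g = toPSL2 (usmx a).
Proof.
rewrite /u /s -toPSL2M; apply/eqP/toPSL2_eqP; right.
by rewrite SL2_valM /= mul_mx2 opp_mx2; congr mx2; ring.
Qed.

Lemma toPSL2X g n : (toPSL2 g ^+ n)%g = toPSL2 (g ^+ n)%g.
Proof. by rewrite /toPSL2 morphX ?pmI_norm. Qed.

(** The exponent starts at 1: the identity would require alpha_(-2) = -1, whereas [alpha] is 0 at
    all negative indices. *)
Lemma val_usmxX a n : val (usmx a ^+ n.+1)%g =
  mx2 (alpha a n.+1) (- alpha a n) (alpha a n) (- alpha a (n%:Z - 1)).
Proof.
elim: n => [|n IH].
  rewrite expg1 alphaS (_ : alpha a (0%:Z - 1) = 0) //.
  by rewrite alpha0 /=; congr mx2; ring.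
rewrite expgS SL2_valM IH mul_mx2 (alphaS a n.+1).
rewrite (_ : n.+1%:Z - 1 = n%:Z :> int); last by lia.
by rewrite (alphaS a n); congr mx2; ring.
Qed.

(** The matrix of [u c * s * u x * h y] has bottom row [(- y, - x / y)]; its opposite is matched
    with [g], and the determinant settles the top right entry. *)
Lemma toPSL2_bruhat g (y : {unit F}) : val y = val g 1 0 ->
  toPSL2 g = (u (bruhat_coord (toPSL2 g)) * s
                * u (val g 1 0 * val g 1 1)%R * h y)%g.
Proof.
move=> yE; have y0 : val y != 0 by rewrite -unitfE (valP y).
suff e : toPSL2 g =
    (u (val g 0 0 / val y)%R * s * u (val g 1 0 * val g 1 1)%R * h y)%g.
  by rewrite {2}e bruhat_coordE.
have dg : val g 0 0 * val g 1 1 - val g 0 1 * val g 1 0 = 1.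
  by rewrite -det_mx22E SL2_det.
rewrite usuhE; apply/eqP/toPSL2_eqP; right.
rewrite SL2_of_prodE opp_mx2 [LHS]mx2_eta; rewrite -yE in dg *.
congr mx2; [by field | | by ring | by field].
by rewrite -[X in X - _ / _ * _]dg; field.
Qed.

(** Outside [B], a Bruhat decomposition would make this entry [y] up to sign, a unit. *)
Lemma toPSL2_in_B g : val g 1 0 = 0 -> toPSL2 g \in B F.
Proof.
move=> g10; apply/negPn/negP => /bruhat_coordP[x [y]].
rewrite usuhE => /eqP/toPSL2_eqP; rewrite SL2_of_prodE.
have y0 : val y != 0 by rewrite -unitfE (valP y).
rewrite opp_mx2; case=> /matrixP/(_ 1 0); rewrite g10 !mxE /= => /esym/eqP.
  by rewrite oppr_eq0 (negPf y0).
by rewrite opprK (negPf y0).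
Qed.

(** The recurrence makes the matrix of the power scalar, and determinant 1 makes it plus or minus
    the identity. *)
Lemma usX_eq1 a n : alpha a n = 0 -> ((u a * s) ^+ n.+1)%g = 1%g.
Proof.
move=> an0; have := SL2_det (usmx a ^+ n.+1)%g; rewrite usE toPSL2X.
have -> : 1%g = toPSL2 (1%g : SL2 F) by rewrite /toPSL2 morph1.
rewrite val_usmxX det_mx2E an0 mulr0 subr0.
have asE := alphaS a n; rewrite an0 mulr0 sub0r in asE.
rewrite -asE -expr2 => /eqP; rewrite sqrf_eq1 => /orP e.
apply/eqP/toPSL2_eqP; rewrite val_usmxX an0 -asE.
rewrite (_ : val (1%g : SL2 F) = mx2 1 0 0 1); last first.
  by apply: mx2_eqP; rewrite !mxE.
by rewrite opp_mx2; case: e => /eqP->; [left | right]; rewrite !oppr0.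
Qed.

(** [g] serves to test membership in [B], [g'] to read off the decomposition; the factor u(-b)
    leaves the first column unchanged. *)
Lemma usX_usu_bottom a b l :
  let g := (usmx a ^+ l * usmx b)%g in
  let g' := (g * MkSL2 (umx_subproof (- b)))%g in
  [/\ val g 1 0 = beta a b (l%:Z - 1), val g' 1 0 = beta a b (l%:Z - 1)
    & val g' 1 1 = - gamma a b (l%:Z - 1)].
Proof.
case: l => [|l] g g'; rewrite /g' /g {g g'} !(SL2_valM, val_usmxX).
  rewrite expg0 /= mul1mx !mul_mx2 !mxE /=.
  by rewrite (_ : gamma a b _ = 0 + b * 1) //; split; ring.
rewrite (_ : l.+1%:Z - 1 = l%:Z :> int); last by lia.
rewrite /= !mul_mx2 !mxE.
by rewrite /gamma /beta /=; split; ring.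
Qed.

End Representatives.

Lemma dvdn_tq (q n : nat) : (q.+1 %| 2 * n)%N = (tq q %| n)%N.
Proof.
have g_gt0 : (0 < gcdn 2 q.+1)%N by rewrite gcdn_gt0.
rewrite /tq dvdn_divLR ?dvdn_gcdr // muln_gcdr mulnC dvdn_gcd.
by rewrite (dvdn_mull _ (dvdnn _)) andbT mulnC.
Qed.

Lemma tq_gt1 q : (1 < q)%N -> (1 < tq q)%N.
Proof.
move=> q1; have tn1 : tq q != 1%N.
  by rewrite -dvdn1 -dvdn_tq muln1; apply/negP => /dvdn_leq; lia.
have : (0 < tq q)%N by rewrite divn_gt0 ?gcdn_gt0 // dvdn_leq ?dvdn_gcdr.
by case: (tq q) tn1 => [|[]].
Qed.

Lemma good_a_alpha_eq0 (F K : finFieldType) (iota : {rmorphism F -> K})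
    (a : F) (n : nat) : good_a iota a ->
  (alpha a n == 0) = (tq #|F| %| n.+1)%N.
Proof.
case=> _ [z zroot zord].
have zE : val z ^+ 2 = iota a * val z - 1.
  move: zroot; rewrite /charpoly_a rmorphD rmorphB /= map_polyXn map_polyZ.
  rewrite map_polyX rmorph1 /root !hornerE => /eqP e.
  by apply/eqP; rewrite -subr_eq0 -[X in _ == X]e; apply/eqP; ring.
have z_eq1 m : (val z ^+ m == 1) = (#|F|.+1 %| m)%N.
  by rewrite -zord order_dvdn -(inj_eq val_inj) FinRing.val_unitX.
have z0 : val z != 0 by rewrite -unitfE (valP z).
have F1 : (1 < #|F|)%N by rewrite card_finNzRing_gt1.
(* The order q + 1 of [z] exceeds 2, so this factor can be cancelled. *)
have z21 : val z ^+ 2 - 1 != 0.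
  by rewrite subr_eq0 z_eq1; apply/negP => /dvdn_leq; lia.
rewrite -dvdn_tq -z_eq1 exprM -[RHS]subr_eq0 -(rmorph_alpha_root n zE).
by rewrite !mulf_eq0 (negPf z21) expf_eq0 (negPf z0) andbF !orbF fmorph_eq0.
Qed.

(* Fq and Fq2 are the fields with q and q ^ 2 elements, and iota is the
   inclusion of Fq in Fq2. *)
Theorem theorem2p21 (q : nat) (Fq Fq2 : finFieldType)
    (hFq : #|Fq| = q) (hFq2 : #|Fq2| = (q ^ 2)%N)
    (iota : {rmorphism Fq -> Fq2}) (a : Fq) (ha : good_a iota a) :
  (forall k : nat, (1 <= k <= tq q - 1)%N ->
     exists2 y : {unit Fq}, val y = alpha a (k%:Z - 1) &
       ((u a * s) ^+ k =
          u (a_seq a k) * s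
            * u (- alpha a (k%:Z - 2) * alpha a (k%:Z - 1))%R * h y)%g) /\
  (odd q -> forall b : Fq, good_b a b ->
   forall l : nat, (0 <= l <= tq q - 1)%N ->
     exists2 y : {unit Fq}, val y = beta a b (l%:Z - 1) &
       ((u a * s) ^+ l * (u b * s * u (- b)) =
          u (b_seq a b l) * s
            * u (- beta a b (l%:Z - 1) * gamma a b (l%:Z - 1))%R * h y)%g).
Proof.
have F1 : (1 < q)%N by rewrite -hFq card_finNzRing_gt1.
have t1 := tq_gt1 F1.
have unit_of (x : Fq) : x != 0 -> exists y : {unit Fq}, val y = x.
  by rewrite -unitfE => xU; exists (FinRing.unit Fq xU).
split=> [[|k] // ltk | _ b gb l ltl].
  rewrite /a_seq (_ : k.+1%:Z - 2 = k%:Z - 1 :> int); last by lia.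
  rewrite (_ : k.+1%:Z - 1 = k%:Z :> int); last by lia.
  have [|y yE] := unit_of (alpha a k).
    by rewrite (good_a_alpha_eq0 _ ha) hFq; apply/negP => /dvdn_leq; lia.
  exists y => //; rewrite usE toPSL2X.
  have E := val_usmxX a k.
  rewrite {1}(@toPSL2_bruhat _ _ y) E !mxE //=.
  by rewrite mulrN mulNr mulrC.
rewrite /b_seq.
have [g10 g'10 g'11] := usX_usu_bottom a b l.
have [|y yE] := unit_of (beta a b (l%:Z - 1)).
  (* The remainder matters only for [l = 0], where [tq q - l] is outside the range covered by
     [good_b]. *)
  apply/eqP => b0; have lt_t : ((tq q - l) %% tq q < tq q)%N.
    by rewrite ltn_mod; lia.
  have /negP[] := gb ((tq q - l) %% tq q)%N ltac:(by rewrite hFq).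
  have ust : ((u a * s) ^+ tq q)%g = 1%g.
    have -> : tq q = (tq q).-1.+1 by lia.
    apply: usX_eq1; apply/eqP; rewrite (good_a_alpha_eq0 _ ha) hFq.
    by rewrite prednK //; lia.
  rewrite expg_mod // mem_lcoset.
  have -> : ((u a * s) ^- (tq q - l) = (u a * s) ^+ l)%g.
    by apply: (mulgI ((u a * s) ^+ (tq q - l))%g);
       rewrite mulgV -expgD subnK ?ust //; lia.
  by rewrite !usE toPSL2X -toPSL2M toPSL2_in_B // g10.
exists y => //.
have -> : ((u a * s) ^+ l * (u b * s * u (- b)))%g =
    toPSL2 (usmx a ^+ l * usmx b * MkSL2 (umx_subproof (- b)))%g.
  by rewrite !usE toPSL2X -!toPSL2M mulgA.
by rewrite {1}(@toPSL2_bruhat _ _ y) g'10 ?g'11 // mulrN mulNr.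
Qed.
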